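(* Let $\Gamma$ be an abelian group, let $R$ be a $\Gamma$-graded gr-prime ring, and let $\mathfrak{a}$ be a nonzero graded (two-sided) ideal of $R$. Suppose $R$ admits a generalized homogeneous derivation $F$ with associated homogeneous derivation $d\neq 0$ such that either $F(xy)+xy\in Z(R)$ for all $x,y\in\mathfrak{a}$, or $F(xy)-xy\in Z(R)$ for all $x,y\in\mathfrak{a}$. Then $R$ is commutative.
   Context: A ring $R$ is $\Gamma$-graded if $R=\bigoplus_{\tau\in\Gamma}R_\tau$ as additive groups with $R_\tau R_\sigma\subseteq R_{\tau\sigma}$; the set of homogeneous elements is $\mathcal{H}(R)=\bigcup_{\tau}R_\tau$. An ideal $\mathfrak{a}$ is graded if $\mathfrak{a}=\bigoplus_{\tau}(\mathfrak{a}\cap R_\tau)$. $R$ is gr-prime if for $a,b\in\mathcal{H}(R)$, $aRb=0$ implies $a=0$ or $b=0$. $Z(R)$ is the center of $R$. A homogeneous derivation is an additive map $d:R\to R$ with $d(xy)=d(x)y+xd(y)$ for all $x,y$ and $d(\mathcal{H}(R))\subseteq\mathcal{H}(R)$. A generalized homogeneous derivation with associated homogeneous derivation $d$ is an additive map $F:R\to R$ such that $F(xy)=F(x)y+xd(y)$ for all $x,y\in R$ and $F(\mathcal{H}(R))\subseteq\mathcal{H}(R)$. *)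

(* Defs.v *)
From HB Require Import structures.
From mathcomp Require Import all_boot all_algebra finmap classical_sets.

Set Implicit Arguments.
Unset Strict Implicit.
Unset Printing Implicit Defensive.

Import GRing.Theory.
Local Open Scope classical_set_scope.
Local Open Scope ring_scope.

(* Associative rings, not necessarily unital and possibly zero: the structures
   of MathComp all have a unit. Unital rings are covered through [rng_of]. *)
HB.mixin Record Zmodule_isRng R of GRing.Zmodule R := {
  rng_mul : R -> R -> R;
  rng_mulA : associative rng_mul;
  rng_mulDl : left_distributive rng_mul +%R;
  rng_mulDr : right_distributive rng_mul +%R
}.

#[short(type="rngType")]
HB.structure Definition Rng := {R of Zmodule_isRng R & GRing.Zmodule R}.

Notation "x ** y" := (rng_mul x y) (at level 40, left associativity) : ring_scope.

Definition rng_of (R : pzRingType) : Type := R.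
HB.instance Definition _ (R : pzRingType) := GRing.Zmodule.on (rng_of R).
HB.instance Definition _ (R : pzRingType) :=
  Zmodule_isRng.Build (rng_of R) (@mulrA R) (@mulrDl R) (@mulrDr R).

Definition additive_subgroup (V : zmodType) (B : set V) : Prop :=
  B 0 /\ forall x y, B x -> B y -> B (x - y).

(* B is the internal direct sum of the subgroups A i. *)
Definition direct_sum (I : choiceType) (V : zmodType) (A : I -> set V)
    (B : set V) : Prop :=
  [/\ forall i, additive_subgroup (A i),
      additive_subgroup B,
      forall i, A i `<=` B &
      forall v, B v -> exists! c : {fsfun I -> V with 0},
        (forall i, A i (c i)) /\ v = \sum_(i <- finsupp c) c i].

(* The abelian grading group is written additively. *)
Definition is_grading (Gamma : zmodType) (R : rngType)
    (gr : Gamma -> set R) : Prop :=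
  direct_sum gr setT /\
  forall s t x y, gr s x -> gr t y -> gr (s + t) (x ** y).

Definition homogeneous (Gamma : zmodType) (R : rngType)
    (gr : Gamma -> set R) : set R :=
  \bigcup_t gr t.

Definition gr_prime (Gamma : zmodType) (R : rngType)
    (gr : Gamma -> set R) : Prop :=
  forall x y, homogeneous gr x -> homogeneous gr y ->
    (forall r, x ** r ** y = 0) -> x = 0 \/ y = 0.

Definition is_ideal (R : rngType) (I : set R) : Prop :=
  additive_subgroup I /\
  forall r x, I x -> I (r ** x) /\ I (x ** r).

Definition graded_ideal (Gamma : zmodType) (R : rngType)
    (gr : Gamma -> set R) (I : set R) : Prop :=
  is_ideal I /\ direct_sum (fun t => I `&` gr t) I.

Definition center (R : rngType) : set R :=
  [set z | forall x, z ** x = x ** z].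

Definition homogeneous_derivation (Gamma : zmodType) (R : rngType)
    (gr : Gamma -> set R) (d : {additive R -> R}) : Prop :=
  (forall x y, d (x ** y) = d x ** y + x ** d y) /\
  (forall x, homogeneous gr x -> homogeneous gr (d x)).

Definition generalized_homogeneous_derivation (Gamma : zmodType) (R : rngType)
    (gr : Gamma -> set R) (F d : {additive R -> R}) : Prop :=
  [/\ homogeneous_derivation gr d,
      forall x y, F (x ** y) = F x ** y + x ** d y &
      forall x, homogeneous gr x -> homogeneous gr (F x)].

(* Main.v *)
Require Import Defs.
From mathcomp Require Import all_boot all_algebra classical_sets.
From mathcomp Require Import boolp.

Set Implicit Arguments.
Unset Strict Implicit.
Unset Printing Implicit Defensive.

Import GRing.Theory.
Local Open Scope classical_set_scope.
Local Open Scope ring_scope.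

(** Both centrality hypotheses say that a map [f], namely [F] plus or minus the
    identity, has central values on products of elements of [I]; this [f] again
    satisfies [f (x ** y) = f x ** y + x ** d y]. Expanding [f (x ** y ** z)]
    shows that [x ** y ** d z] commutes with [z], and replacing [x] by [r ** x]
    turns this into [[r, z] ** (x ** y) ** d z = 0] for all [r] and [z]
    ([commutator_annihilates_der]).

    The map [f] need not preserve homogeneity, but it has disappeared from this
    identity. For homogeneous [r] and [z], the commutator [[r, z]] is
    homogeneous because the grading group is abelian, and [d z] is homogeneous
    by assumption. Gr-primeness, which passes to nonzero graded ideals
    ([gr_prime_ideal]), then gives the dichotomy that a homogeneous [z] is
    central or killed by [d].

    Finally, fix a homogeneous [z0] with [d z0 <> 0]. It is central, hence so is
    [d z0], and a nonzero central homogeneous element is not a zero divisor on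
    homogeneous elements. If [u] is a nonzero homogeneous element with
    [d u = 0], then [d (u ** z0) = u ** d z0 <> 0], so [u ** z0] is central by
    the dichotomy, and cancelling [z0] makes [u] central. *)

Section RngTheory.
Variable R : rngType.
Implicit Types x y z : R.

Lemma rng_mul0r x : 0 ** x = 0.
Proof. by apply: (addrI (0 ** x)); rewrite -rng_mulDl !addr0. Qed.

Lemma rng_mulr0 x : x ** 0 = 0.
Proof. by apply: (addrI (x ** 0)); rewrite -rng_mulDr !addr0. Qed.

Lemma rng_mulNr x y : (- x) ** y = - (x ** y).
Proof. by apply: (addrI (x ** y)); rewrite -rng_mulDl !subrr rng_mul0r. Qed.

Lemma rng_mulBl x y z : (x - y) ** z = x ** z - y ** z.
Proof. by rewrite rng_mulDl rng_mulNr. Qed.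

End RngTheory.

(** A graded ideal is generated, as an additive group, by its homogeneous
    elements; this is the form in which the decomposition of an element into
    homogeneous components is used below. *)
Lemma homogeneous_ind (Gamma : zmodType) (R : rngType) (gr : Gamma -> set R)
    (I P : set R) :
  direct_sum (fun t => I `&` gr t) I ->
  P 0 -> (forall x y, P x -> P y -> P (x + y)) ->
  (forall x, I x -> homogeneous gr x -> P x) -> forall x, I x -> P x.
Proof.
move=> [_ _ _ dec] P0 PD Ph x /dec [c [[cP ->] _]].
elim/big_ind: _ => // i _; have [Ic gc] := cP i.
by apply: Ph => //; exists i.
Qed.

Section GradedRing.
Variables (Gamma : zmodType) (R : rngType) (gr : Gamma -> set R).
Hypothesis R_graded : is_grading gr.

Lemma grading_ind (P : set R) :
  P 0 -> (forall x y, P x -> P y -> P (x + y)) ->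
  (forall x, homogeneous gr x -> P x) -> forall x, P x.
Proof.
move=> P0 PD Ph x; apply: (@homogeneous_ind _ _ gr setT P) => //; last first.
  by move=> y _; exact: Ph.
rewrite (_ : (fun t => _) = gr); first by case: R_graded.
by apply/funext => t; rewrite setTI.
Qed.

Lemma homogeneousM x y :
  homogeneous gr x -> homogeneous gr y -> homogeneous gr (x ** y).
Proof.
by move=> [s _ sx] [t _ ty]; exists (s + t) => //; apply: R_graded.2.
Qed.

(** This is where commutativity of the grading group enters: both products lie
    in the same component. *)
Lemma homogeneous_commutator x y :
  homogeneous gr x -> homogeneous gr y ->
  homogeneous gr (x ** y - y ** x).
Proof.
move=> [s _ sx] [t _ ty]; exists (s + t) => //.
have [[grB _ _ _] grM] := R_graded.
have [_ subP] := grB (s + t).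
by apply: subP; [|rewrite addrC]; apply: grM.
Qed.

Hypothesis R_prime : gr_prime gr.

(** Primeness tested against homogeneous elements [r] only; then [x ** r] and
    [r ** y] stay homogeneous, so the test can be iterated. *)
Lemma gr_prime_homogeneous x y :
  homogeneous gr x -> homogeneous gr y ->
  (forall r, homogeneous gr r -> x ** r ** y = 0) -> x = 0 \/ y = 0.
Proof.
move=> hx hy xry0; apply: R_prime => //.
apply: grading_ind => // [|r s rP sP]; first by rewrite rng_mulr0 rng_mul0r.
by rewrite rng_mulDr rng_mulDl rP sP addr0.
Qed.

Lemma central_cancel x z :
  homogeneous gr x -> homogeneous gr z -> @center R z ->
  x ** z = 0 -> x = 0 \/ z = 0.
Proof.
move=> hx hz zZ xz0; apply: R_prime => // r.
by rewrite -rng_mulA -zZ rng_mulA xz0 rng_mul0r.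
Qed.

Lemma central_homogeneous z :
  (forall r, homogeneous gr r -> r ** z = z ** r) -> @center R z.
Proof.
move=> zP; apply: grading_ind => [|r s rP sP|r /zP //].
  by rewrite rng_mulr0 rng_mul0r.
by rewrite rng_mulDr rng_mulDl rP sP.
Qed.

Variable I : set R.
Hypothesis I_graded : graded_ideal gr I.
Hypothesis I_neq0 : I <> [set 0].

Lemma graded_ideal_homogeneous_neq0 :
  exists a, [/\ I a, homogeneous gr a & a <> 0].
Proof.
have [[[I0 _] _] I_sum] := I_graded.
apply: contrapT => noa; apply: I_neq0; apply/seteqP; split=> x /=; last first.
  by move=> ->.
apply: (@homogeneous_ind _ _ gr I [set 0] I_sum) => //=.
  by move=> y z -> ->; rewrite addr0.
by move=> y Iy hy; apply: contrapT => yn0; apply: noa; exists y.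
Qed.

(** In a gr-prime ring a nonzero graded ideal is large enough to witness
    primeness. Sandwich a nonzero homogeneous [a] of [I]: if [x] and [y] are nonzero then so are [x ** r ** a]
    and [a ** s ** y] for suitable homogeneous [r] and [s], and these two
    contradict gr-primeness. *)
Lemma gr_prime_ideal x y :
  homogeneous gr x -> homogeneous gr y ->
  (forall a b, I a -> I b -> x ** (a ** b) ** y = 0) -> x = 0 \/ y = 0.
Proof.
move=> hx hy xIIy0.
have [a [Ia ha an0]] := graded_ideal_homogeneous_neq0.
have [[_ I_mul] _] := I_graded.
apply: contrapT => /not_orP [xn0 yn0].
have [r hr xran0] : exists2 r, homogeneous gr r & x ** r ** a <> 0.
  apply: contrapT => nor; have [] // := gr_prime_homogeneous hx ha.
  by move=> r hr; apply: contrapT => xra; apply: nor; exists r.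
have [s hs asyn0] : exists2 s, homogeneous gr s & a ** s ** y <> 0.
  apply: contrapT => nos; have [] // := gr_prime_homogeneous ha hy.
  by move=> s hs; apply: contrapT => asy; apply: nos; exists s.
have [] // := R_prime (homogeneousM (homogeneousM hx hr) ha)
                      (homogeneousM (homogeneousM ha hs) hy).
move=> t; have := xIIy0 (r ** a) (t ** (a ** s)) (I_mul _ _ Ia).1
                  (I_mul _ _ (I_mul _ _ Ia).2).1.
by rewrite !rng_mulA.
Qed.

End GradedRing.

(** Centrality of [f (x ** y ** z)] makes [x ** y ** d z] commute with [z]. Since
    [I] is an ideal, so does [r ** x ** y ** d z], and the difference between
    this and [r] times the first relation is the conclusion. *)
Lemma commutator_annihilates_der (R : rngType) (I : set R) (f d : R -> R) :
  is_ideal I ->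
  (forall x y, f (x ** y) = f x ** y + x ** d y) ->
  (forall x y, I x -> I y -> @center R (f (x ** y))) ->
  forall r z x y, I x -> I y -> (r ** z - z ** r) ** (x ** y) ** d z = 0.
Proof.
move=> [_ I_mul] fM fZ r z x y Ix Iy.
have der_comm a b : I a -> I b -> a ** b ** d z ** z = z ** (a ** b ** d z).
  move=> Ia Ib; have := fZ a (b ** z) Ia (I_mul z b Ib).2 z.
  rewrite rng_mulA fM rng_mulDl rng_mulDr.
  (* The first summands agree because [f (a ** b)] is central. *)
  by rewrite [z ** (_ ** z)]rng_mulA -(fZ a b Ia Ib z) => /addrI.
rewrite !rng_mulBl; apply/eqP; rewrite subr_eq0; apply/eqP.
have := der_comm (r ** x) y (I_mul r x Ix).1 Iy.
have := congr1 (rng_mul r) (der_comm x y Ix Iy).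
by rewrite !rng_mulA => ->.
Qed.

Section HomogeneousDerivation.
Variables (Gamma : zmodType) (R : rngType) (gr : Gamma -> set R).
Variable d : {additive R -> R}.
Hypothesis R_graded : is_grading gr.
Hypothesis R_prime : gr_prime gr.
Hypothesis d_der : homogeneous_derivation gr d.

Lemma der_central z : @center R z -> @center R (d z).
Proof.
move=> zZ r; have := congr1 d (zZ r); rewrite !d_der.1.
by rewrite [d z ** r + _]addrC zZ => /addrI.
Qed.

Lemma homogeneous_der_neq0 :
  ~ (forall x, d x = 0) -> exists2 z, homogeneous gr z & d z <> 0.
Proof.
move=> d_neq0; apply: contrapT => noz; apply: d_neq0.
apply: (grading_ind R_graded) => [|x y xP yP|x hx]; first exact: raddf0.
  by rewrite raddfD xP yP addr0.
by apply: contrapT => dx; apply: noz; exists x.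
Qed.

(** An element killed by [d] is moved out of the kernel of [d] by multiplying
    it by a central element outside that kernel, so that the first alternative
    applies to the product. *)
Lemma commutative_of_central_or_constant :
  ~ (forall x, d x = 0) ->
  (forall z, homogeneous gr z -> @center R z \/ d z = 0) ->
  forall x y : R, x ** y = y ** x.
Proof.
move=> d_neq0 dichotomy.
have [z0 hz0 dz0] := homogeneous_der_neq0 d_neq0.
have z0Z : @center R z0 by case: (dichotomy z0 hz0).
have z0n0 : z0 <> 0 by move=> z00; apply: dz0; rewrite z00 raddf0.
apply: (grading_ind R_graded) => [y|u v uP vP y|u hu].
- by rewrite rng_mulr0 rng_mul0r.
- by rewrite rng_mulDr rng_mulDl uP vP.
have [//|du0] := dichotomy u hu.
have [uz0Z|] := dichotomy _ (homogeneousM R_graded hu hz0); last first.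
  rewrite d_der.1 du0 rng_mul0r add0r => udz0.
  have [-> y|//] := central_cancel R_prime hu (d_der.2 _ hz0)
                                    (der_central z0Z) udz0.
  by rewrite rng_mulr0 rng_mul0r.
apply: (central_homogeneous R_graded) => r hr.
have ruz00 : (r ** u - u ** r) ** z0 = 0.
  by rewrite rng_mulBl -2!rng_mulA -uz0Z -(z0Z r) rng_mulA subrr.
by have [/subr0_eq|] := central_cancel R_prime
  (homogeneous_commutator R_graded hr hu) hz0 z0Z ruz00.
Qed.

End HomogeneousDerivation.

Theorem theorem4p8 (Gamma : zmodType) (R : rngType) (gr : Gamma -> set R)
    (I : set R) (F d : {additive R -> R})
    (R_graded : is_grading gr) (R_prime : gr_prime gr)
    (I_graded : graded_ideal gr I) (I_neq0 : I <> [set 0])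
    (F_der : generalized_homogeneous_derivation gr F d)
    (d_neq0 : ~ (forall x, d x = 0))
    (F_central :
      (forall x y, I x -> I y -> @center R (F (x ** y) + x ** y)) \/
      (forall x y, I x -> I y -> @center R (F (x ** y) - x ** y))) :
  forall x y : R, x ** y = y ** x.
Proof.
have [d_der FM _] := F_der.
have annih r z x y :
    I x -> I y -> (r ** z - z ** r) ** (x ** y) ** d z = 0.
  have I_ideal := I_graded.1.
  case: F_central => fZ.
    apply: (commutator_annihilates_der (f := fun x => F x + x)) => // a b.
    by rewrite FM rng_mulDl addrAC.
  apply: (commutator_annihilates_der (f := fun x => F x - x)) => // a b.
  by rewrite FM rng_mulBl addrAC.
apply: (commutative_of_central_or_constant R_graded R_prime d_der d_neq0).
move=> z hz; apply: contrapT => /not_orP [zNZ dzn0]; apply: zNZ.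
apply: (central_homogeneous R_graded) => r hr.
have [/subr0_eq //|//] := gr_prime_ideal R_graded R_prime I_graded I_neq0
  (homogeneous_commutator R_graded hr hz) (d_der.2 _ hz)
  (fun x y => @annih r z x y).
Qed.
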